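(* For any integers $N\ge 1$ and $d\ge 0$ we have the identity of polynomials in $q$ \[q^{\frac{N(N-1)}{2}}\,[N]_q\,\genfrac{[}{]}{0pt}{}{d+2}{N+1}_q=s_{(2,1^{N-1})}(1,q,\ldots,q^d).\]
   Context: Here $[N]_q=1+q+\cdots+q^{N-1}$, and $\genfrac{[}{]}{0pt}{}{a}{b}_q$ is the $q$-binomial coefficient, i.e. $\frac{[a]_q[a-1]_q\cdots[a-b+1]_q}{[b]_q[b-1]_q\cdots[1]_q}$, which is $0$ if $b>a$. The Schur function labelled by a partition $\lambda$ is $s_\lambda$; thus $s_\lambda(1,q,\ldots,q^d)$ is the sum of $q^{(\text{sum of the entries of }t)}$ over all semistandard Young tableaux $t$ of shape $\lambda$ (rows weakly increasing, columns strictly increasing) with entries from $\{0,1,\ldots,d\}$. The partition $(2,1^{N-1})$ has one part $2$ and $N-1$ parts $1$. *)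

(* Defs.v *)
From HB Require Import structures.
From mathcomp Require Import all_boot all_order all_algebra.
From mathcomp Require Import ring.

Set Implicit Arguments.
Unset Strict Implicit.
Unset Printing Implicit Defensive.

Import GRing.Theory.
Local Open Scope ring_scope.

(* The formal variable q is 'X : {poly int}. *)
Definition qint (n : nat) : {poly int} := \sum_(i < n) 'X^i.

(* [a]_q [a-1]_q ... [a-b+1]_q.  Truncated subtraction is harmless: if b > a,
   the factor of index i = a is [0]_q = 0. *)
Definition qfall (a b : nat) : {poly int} := \prod_(i < b) qint (a - i).

(* The quotient is a Euclidean division by a monic polynomial; it is exact by
   qbinomK below. *)
Definition qbinom (a b : nat) : {poly int} := qfall a b %/ qfall b b.

(* Cells of the diagram of lam = [:: lam_0; lam_1; ...], with 0-based row
   [tag c] and column [tagged c] (English convention). *)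
Definition cell (lam : seq nat) : finType :=
  {i : 'I_(size lam) & 'I_(nth 0%N lam i)}.

Definition row_of (lam : seq nat) (c : cell lam) : nat := tag c.
Definition col_of (lam : seq nat) (c : cell lam) : nat := tagged c.

Definition semistandard (n : nat) (lam : seq nat)
    (t : {ffun cell lam -> 'I_n}) : bool :=
  [forall c, forall c',
     ((row_of c == row_of c') && (col_of c < col_of c')%N ==> (t c <= t c')%N)
  && ((col_of c == col_of c') && (row_of c < row_of c')%N ==> (t c < t c')%N)].

(* s_lam(x_0, ..., x_{n-1}), for lam a partition (weakly decreasing). *)
Definition schur (R : comNzRingType) (n : nat) (lam : seq nat)
    (x : 'I_n -> R) : R :=
  \sum_(t : {ffun cell lam -> 'I_n} | semistandard t) \prod_c x (t c).

Lemma schur_principal (n : nat) (lam : seq nat) :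
  schur lam (fun i : 'I_n => 'X^i : {poly int}) =
  \sum_(t : {ffun cell lam -> 'I_n} | semistandard t) 'X^(\sum_c t c).
Proof. by apply: eq_bigr => t _; rewrite prodrXr. Qed.

Lemma qintD (m n : nat) : qint (m + n) = qint m + 'X^m * qint n.
Proof.
rewrite /qint big_split_ord /= mulr_sumr; congr (_ + _).
by apply: eq_bigr => i _; rewrite exprD.
Qed.

Lemma qfall_small (a b : nat) : (a < b)%N -> qfall a b = 0.
Proof.
by move=> ab; rewrite /qfall (bigD1 (Ordinal ab)) //= subnn /qint big_ord0 mul0r.
Qed.

Lemma qfallSS (a b : nat) : qfall a.+1 b.+1 = qint a.+1 * qfall a b.
Proof. by rewrite /qfall big_ord_recl subn0. Qed.

Lemma qfallSr (a b : nat) : qfall a b.+1 = qfall a b * qint (a - b).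
Proof. by rewrite /qfall big_ord_recr. Qed.

Lemma monic_qfall (b : nat) : qfall b b \is monic.
Proof.
apply: monic_prod => i _; rewrite -(subnSK (ltn_ord i)).
have -> n : qint n.+1 = \poly_(i < n.+1) 1.
  by rewrite poly_def; apply: eq_bigr => j _; rewrite scale1r.
by rewrite monicE lead_coef_poly ?oner_eq0.
Qed.

Lemma qbinomK (a b : nat) : qbinom a b * qfall b b = qfall a b.
Proof.
suff [g gE] : exists g, qfall a b = g * qfall b b.
  by rewrite /qbinom gE Pdiv.IdomainMonic.mulpK ?monic_qfall.
elim: a b => [|a IHa] [|b].
- by exists 1; rewrite mul1r.
- by exists 0; rewrite qfall_small ?mul0r.
- by exists 1; rewrite mul1r /qfall !big_ord0.
have [[g gE] [h hE]] := (IHa b, IHa b.+1).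
exists (g + 'X^(b.+1) * h).
rewrite mulrDl -mulrA -hE (qfallSS b) mulrCA -gE qfallSS qfallSr.
have [ab | ba] := ltnP a b; first by rewrite qfall_small // !(mul0r, mulr0) addr0.
by rewrite mulrCA [RHS]addrC -{1}(subnKC ba) -addSn qintD mulrDl; ring.
Qed.

(* Main.v *)
Require Import Defs.
From mathcomp Require Import all_boot all_order all_algebra.
From mathcomp Require Import ring.
Import GRing.Theory.
Local Open Scope ring_scope.

(** The hook Schur function is a difference of products of elementary
    symmetric functions.  A filling of the shape (2, 1^k) consists of its first
    column, a strictly increasing sequence [c] of length [k + 1], and the entry
    [u] of the one remaining cell, at the right of the head of [c].  Among all
    pairs [(c, u)], which contribute [e_1 * e_(k+1)], the semistandard ones are
    those with [c_0 <= u]; the others satisfy [u < c_0], so that [u :: c] is an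
    arbitrary strictly increasing sequence of length [k + 2].  Hence
    [s_(2,1^k) = e_1 * e_(k+1) - e_(k+2)] in any number of variables
    ([schur_hook]).

    At [x_i = q^i], with [n] variables, [e_k] is [q^'C(k,2) * qbinom n k].  This
    comes from the q-Pascal rule, by discarding the variables one at a time
    from the smallest index on; to make this an induction, [elem_above]
    restricts the elementary symmetric function to indices at least [m]
    ([elem_above_principal]).  Taking out the power [q^'C(N,2)], what remains is
    the identity
    [[N] * qbinom (n+1) (N+1) = [n] * qbinom n N - q^N * qbinom n (N+1)]
    ([qint_mul_qbinom]). *)

Lemma qbinom0 (a : nat) : qbinom a 0 = 1.
Proof.
have q0 b : qfall b 0 = 1 by rewrite /qfall big_ord0.
by rewrite -[LHS]mulr1 -(q0 0%N) qbinomK q0.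
Qed.

Lemma qbinom_small (a b : nat) : (a < b)%N -> qbinom a b = 0.
Proof. by move=> ab; rewrite /qbinom qfall_small // div0p. Qed.

(** The q-Pascal rule.  Identities between q-binomials are checked after
    multiplication by the monic, hence cancellable, common denominator. *)
Lemma qbinomS (a k : nat) :
  qbinom a.+1 k.+1 = qbinom a k + 'X^(k.+1) * qbinom a k.+1.
Proof.
apply: (mulIf (monic_neq0 (monic_qfall k.+1))).
rewrite mulrDl -mulrA !qbinomK (qfallSS k) mulrCA qbinomK qfallSS qfallSr.
have [ak | ka] := ltnP a k; first by rewrite qfall_small // !(mul0r, mulr0) addr0.
by rewrite -{1}(subnKC ka) -addSn qintD; ring.
Qed.

(** With [n = k + m], and after cancelling the common factor, this reduces to
    [[k] * [n+1] = [n] * [k+1] - q^k * [m]], which holds since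
    [[n] = [k] + q^k * [m]]. *)
Lemma qint_mul_qbinom (n k : nat) :
  qint k * qbinom n.+1 k.+1 = qint n * qbinom n k - 'X^k * qbinom n k.+1.
Proof.
apply: (mulIf (monic_neq0 (monic_qfall k.+1))).
rewrite mulrBl -!mulrA !qbinomK (qfallSS k) (mulrCA (qbinom n k)) qbinomK.
rewrite qfallSS qfallSr.
have [nk | kn] := ltnP n k; first by rewrite qfall_small // !(mul0r, mulr0) subr0.
have q1 : qint 1 = 1 by rewrite /qint big_ord1.
have qnk : qint n = qint k + 'X^k * qint (n - k) by rewrite -qintD subnKC.
have qS j : qint j.+1 = 1 + 'X * qint j by rewrite -add1n qintD q1 expr1.
by rewrite !qS qnk; ring.
Qed.

Definition ord_lt (n : nat) : rel 'I_n := fun a b => (a < b)%N.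

Lemma ord_lt_trans (n : nat) : transitive (ord_lt n).
Proof. by move=> b a c; apply: ltn_trans. Qed.

(** The elementary symmetric function of degree [k] in the variables [x_i] with
    [m <= i]: subsets of size [k] are encoded by their increasing enumerations,
    which is also the form in which the first column of a tableau appears. *)
Definition elem_above {R : comNzRingType} {n : nat} (x : 'I_n -> R)
    (k m : nat) : R :=
  \sum_(t : k.-tuple 'I_n |
        sorted (ord_lt n) t && all (fun i : 'I_n => m <= i)%N t)
    \prod_(i <- t) x i.

Lemma big_tuple_cons (R : nmodType) (T : finType) (k : nat)
    (P : pred (seq T)) (F : seq T -> R) :
  \sum_(t : k.+1.-tuple T | P t) F t =
  \sum_a \sum_(t : k.-tuple T | P (a :: t)) F (a :: t).
Proof.
rewrite pair_big_dep /=.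
rewrite (reindex (fun p : T * k.-tuple T => [tuple of p.1 :: p.2])) //=.
exists (fun t : k.+1.-tuple T => (thead t, [tuple of behead t])) => [[a t]|t] _ /=.
  by rewrite theadE; congr (_, _); apply: val_inj.
by rewrite [RHS]tuple_eta; apply: val_inj.
Qed.

Section ElemAbove.
Variables (R : comNzRingType) (n : nat) (x : 'I_n -> R).

Lemma elem_above0 (m : nat) : elem_above x 0 m = 1.
Proof.
rewrite /elem_above (big_pred1 [tuple]) ?big_nil // => t.
by rewrite [t]tuple0 [RHS]eqxx.
Qed.

(** Classify the increasing sequences by their smallest entry [u]. *)
Lemma elem_aboveS (k m : nat) :
  elem_above x k.+1 m = \sum_(u : 'I_n | (m <= u)%N) x u * elem_above x k u.+1.
Proof.
rewrite /elem_above.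
rewrite (big_tuple_cons _ _ _ (fun s => sorted _ s && all _ s)
                        (fun s => \prod_(i <- s) x i)).
rewrite [RHS]big_mkcond; apply: eq_bigr => u _ /=.
have [mu|mu] := boolP (m <= u)%N; last first.
  by rewrite big_pred0 // => t; rewrite andbF.
rewrite big_distrr; apply: eq_big => [t|t _] /=; last by rewrite big_cons.
rewrite (path_sortedE (ord_lt_trans n)) andbAC andbC.
(* The remaining entries exceed [u], so the bound [m] on them is automatic. *)
congr (_ && _); apply: andb_idr => /allP ut.
by apply/allP => i /ut /ltnW; apply: leq_trans.
Qed.

Lemma elem_above_large (k m : nat) : (n <= m)%N -> elem_above x k.+1 m = 0.
Proof.
move=> nm; rewrite elem_aboveS big_pred0 // => u.
by rewrite leqNgt (leq_trans (ltn_ord u) nm).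
Qed.

(** A subset of the indices [>= m] either contains [m] or does not: this is the
    recursion that becomes the q-Pascal rule. *)
Lemma elem_above_rec (k : nat) (m : 'I_n) :
  elem_above x k.+1 m = x m * elem_above x k m.+1 + elem_above x k.+1 m.+1.
Proof.
rewrite !elem_aboveS (bigD1 m) //=; congr (_ + _).
by apply: eq_bigl => u; rewrite andbC ltn_neqAle eq_sym.
Qed.

End ElemAbove.

(** The extra factor [q^(k * m)] accounts for the shift by [m] of the [k]
    chosen indices; both sides vanish when [n - m] truncates to 0 and
    [0 < k]. *)
Lemma elem_above_principal (n k m : nat) :
  elem_above (fun i : 'I_n => 'X^i : {poly int}) k m =
  'X^('C(k, 2) + k * m) * qbinom (n - m) k.
Proof.
case: k => [|k]; first by rewrite elem_above0 qbinom0 mulr1.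
move jE : (n - m)%N => j; elim: j k m jE => [|j IHj] k m jE.
  by rewrite elem_above_large ?qbinom_small ?mulr0 // -subn_eq0 jE.
have mn : (m < n)%N by rewrite -subn_gt0 jE.
have jE' : (n - m.+1)%N = j by rewrite subnS jE.
rewrite (elem_above_rec _ _ _ k (Ordinal mn)) /= IHj // qbinomS mulrDr mulrA -exprD.
congr (_ + _); last first.
  by congr ('X^_ * _); rewrite (mulnS k.+1); ring.
case: k => [|k].
  by rewrite elem_above0 qbinom0 !mulr1 bin_small // mul1n.
rewrite IHj // mulrA -exprD; congr ('X^_ * _).
by rewrite (binS k.+1 1) bin1 mulnS; ring.
Qed.

(** Cells are dependent pairs; this lemma and [cell_inj] allow them to be
    handled through their row and column numbers only. *)
Lemma cell_at (lam : seq nat) (i j : nat) :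
  (i < size lam)%N -> (j < nth 0 lam i)%N ->
  {b : cell lam | row_of b = i & col_of b = j}.
Proof.
move=> il jl.
by exists (Tagged (fun i : 'I_(size lam) => 'I_(nth 0%N lam i))
                  (Ordinal jl : 'I_(nth 0%N lam (Ordinal il)))).
Qed.

Lemma cell_inj (lam : seq nat) (b b' : cell lam) :
  row_of b = row_of b' -> col_of b = col_of b' -> b = b'.
Proof.
case: b b' => [i j] [i' j']; rewrite /row_of /col_of /= => /val_inj ii'.
by move: j'; rewrite -ii' => j' /val_inj ->.
Qed.

Lemma big_cell (R : comNzRingType) (lam : seq nat) (F : nat -> nat -> R) :
  \prod_(b : cell lam) F (row_of b) (col_of b) =
  \prod_(0 <= i < size lam) \prod_(0 <= j < nth 0%N lam i) F i j.
Proof.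
rewrite /row_of /col_of big_mkord.
rewrite -(sig_big_dep xpredT (fun _ => xpredT)
            (fun i j => F (nat_of_ord i) (nat_of_ord j))) /=.
by apply: eq_bigr => i _; rewrite big_mkord.
Qed.

Section Hook.
Variables (n k : nat).
Let lam : seq nat := 2%N :: nseq k 1%N.

Lemma row_hook (b : cell lam) : (row_of b < k.+1)%N.
Proof. by rewrite /row_of (leq_trans (ltn_ord _)) //= size_nseq. Qed.

Lemma col_hook (b : cell lam) :
  col_of b = 0%N \/ row_of b = 0%N /\ col_of b = 1%N.
Proof.
case: b => [[[|i] il] [j /= jl]]; rewrite /row_of /col_of /=.
  by case: j jl => [|[|j]]; auto.
by move: jl; rewrite nth_nseq; case: ifP => // _; case: j; auto.
Qed.

Lemma cell_col0 (i : nat) : (i < k.+1)%N ->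
  {b : cell lam | row_of b = i & col_of b = 0%N}.
Proof.
move=> ik; apply: cell_at; first by rewrite /= size_nseq.
by case: i ik => //= i ik; rewrite nth_nseq ifT.
Qed.

Lemma cell_arm : {b : cell lam | row_of b = 0%N & col_of b = 1%N}.
Proof. exact: cell_at. Qed.

(** The default value [u] of [nth] is never reached, by [row_hook]. *)
Definition hook_filling (c : k.+1.-tuple 'I_n) (u : 'I_n) :
    {ffun cell lam -> 'I_n} :=
  [ffun b => if col_of b == 0%N then nth u c (row_of b) else u].

Lemma semistandard_hook (c : k.+1.-tuple 'I_n) (u : 'I_n) :
  semistandard (hook_filling c u) = sorted (ord_lt n) c && (thead c <= u)%N.
Proof.
have c0 : thead c = nth u c 0 by rewrite /thead (tnth_nth u).
rewrite c0; apply/forallP/andP => [ss | [sc cu] b].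
  have ssP b b' := forallP (ss b) b'; split.
    apply/(sortedP u) => i; rewrite size_tuple => ik.
    have [b rb cb] := cell_col0 i (ltnW ik).
    have [b' rb' cb'] := cell_col0 i.+1 ik.
    by have := ssP b b'; rewrite !ffunE rb rb' cb cb' /= ltnSn /= andbC => /andP[].
  have [b rb cb] := cell_col0 0 isT; have [b' rb' cb'] := cell_arm.
  by have := ssP b b'; rewrite !ffunE rb rb' cb cb' /= andbT.
apply/forallP => b'; rewrite !ffunE; apply/andP; split; apply/implyP => /andP[].
  move=> /eqP rr; case: (col_hook b) => [->|[_ ->]] /=.
    by case: (col_hook b') => [->|[r0 ->]] //= _; rewrite rr r0.
  by case: (col_hook b') => [->|[_ ->]].
move=> /eqP cc; case: (col_hook b') => [c'0 rr|[-> _] //].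
rewrite cc c'0 /=.
by apply: (sorted_ltn_nth (ord_lt_trans n) u sc) => //; rewrite inE size_tuple row_hook.
Qed.

(** The inverse reads the first column and the cell at row 0, column 1 off a
    filling. *)
Lemma hook_filling_bij :
  bijective (fun p : 'I_n * k.+1.-tuple 'I_n => hook_filling p.2 p.1).
Proof.
pose col (t : {ffun cell lam -> 'I_n}) :=
  [tuple t (s2val (cell_col0 i (ltn_ord i))) | i < k.+1].
exists (fun t : {ffun cell lam -> 'I_n} => (t (s2val cell_arm), col t))
  => [[u c]|t] /=; last first.
  apply/ffunP => b; rewrite ffunE.
  case: (col_hook b) => [c0|[r0 c1]]; rewrite ?c0 ?c1 /=; last first.
    congr (t _); case: cell_arm => b' rb cb /=.
    by apply: (@cell_inj lam); rewrite ?rb ?cb.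
  rewrite -(tnth_nth _ (col t) (Ordinal (row_hook b))) tnth_mktuple.
  congr (t _); case: cell_col0 => b' rb cb /=.
  by apply: (@cell_inj lam); rewrite ?rb ?cb.
congr (_, _); first by rewrite ffunE; case: cell_arm => b /= _ ->.
apply: eq_from_tnth => i; rewrite tnth_mktuple ffunE.
by case: cell_col0 => b /= -> ->; rewrite eqxx (tnth_nth u).
Qed.

Lemma prod_hook (R : comNzRingType) (x : 'I_n -> R) c u :
  \prod_b x (hook_filling c u b) = (\prod_(i <- c) x i) * x u.
Proof.
under eq_bigr => b _ do rewrite ffunE.
rewrite (big_cell _ lam (fun i j => x (if j == 0%N then nth u c i else u))).
rewrite big_nat_recl //= big_nat_recl //= big_nat1.
rewrite (big_nth u) size_tuple [in RHS]big_nat_recl // [LHS]mulrAC.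
rewrite -/(size (nseq k 1%N)) size_nseq; congr (_ * _ * _); apply: eq_big_nat => i /andP[_ ik].
by rewrite nth_nseq ik big_nat1.
Qed.

End Hook.

(** The case [e_1 * e_(k+1) = s_(2,1^k) + s_(1^(k+2))] of the Pieri rule. *)
Lemma schur_hook (R : comNzRingType) (n k : nat) (x : 'I_n -> R) :
  schur (2%N :: nseq k 1%N) x =
  (\sum_u x u) * elem_above x k.+1 0 - elem_above x k.+2 0.
Proof.
rewrite /schur (reindex _ (onW_bij _ (hook_filling_bij n k))) /=.
under eq_bigl => p do rewrite semistandard_hook.
under eq_bigr => p _ do rewrite prod_hook.
have elem0 j : elem_above x j 0 =
    \sum_(t : j.-tuple 'I_n | sorted (ord_lt n) t) \prod_(i <- t) x i.
  by apply: eq_bigl => t; rewrite andb_idr // => _; apply/allP.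
rewrite !elem0.
rewrite (big_tuple_cons _ _ k.+1 (sorted (ord_lt n)) (fun s => \prod_(i <- s) x i)).
rewrite mulr_suml -sumrB.
rewrite -(pair_big_dep xpredT
  (fun (u : 'I_n) (c : k.+1.-tuple 'I_n) => sorted (ord_lt n) c && (thead c <= u)%N)
  (fun u c => (\prod_(i <- c) x i) * x u)) /=.
apply: eq_bigr => u _; apply/eqP; rewrite eq_sym subr_eq; apply/eqP.
rewrite mulr_sumr (bigID (fun c : k.+1.-tuple 'I_n => thead c <= u)%N) /=.
(* The pairs with [u < thead c] are the increasing sequences [u :: c]. *)
congr (_ + _); first by apply: eq_bigr => c _; rewrite mulrC.
apply: eq_big => [c | c _]; last by rewrite big_cons.
by case/tupleP: c => a c; rewrite theadE /= andbC -ltnNge.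
Qed.

Theorem corollary3p2 (N d : nat) (hN : (1 <= N)%N) :
  'X^(N * (N - 1) %/ 2)%N * qint N * qbinom (d + 2) (N + 1) =
  schur (2%N :: nseq (N - 1) 1%N) (fun i : 'I_(d + 1) => 'X^i : {poly int}).
Proof.
case: N hN => // k _; rewrite subn1 /= schur_hook !elem_above_principal.
rewrite !addn1 addn2 subn0 !muln0 !addn0.
rewrite -mulrA qint_mul_qbinom.
have -> : (k.+1 * k %/ 2 = 'C(k.+1, 2))%N by rewrite bin2 -divn2.
rewrite (binS k.+1 1) bin1 exprD -/(qint d.+1).
by ring.
Qed.
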